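(* Let $S$ be a semidomain. Then $S$ is quasi-atomic if and only if every nonzero prime ideal of $S$ contains an atom of $S$.
   Context: A monoid here is a commutative cancellative semigroup with identity. A semiring is a set $S$ with two operations $+$ and $\cdot$ such that $(S,+)$ is a (commutative, cancellative) monoid with identity $0$, $(S,\cdot)$ is a commutative semigroup with identity $1$, and multiplication distributes over addition. A subsemiring of a semiring (or ring) is an additive submonoid that contains $1$ and is closed under multiplication. A semidomain is a semiring that is a subsemiring of an integral domain. For a semidomain $S$, write $S^* := (S\setminus\{0\},\cdot)$, which is a monoid, called the multiplicative monoid of $S$. For a monoid $M$ (written multiplicatively), a unit is an invertible element; an atom of $M$ is a nonunit $a \in M$ such that $a = bc$ with $b,c\in M$ implies that $b$ or $c$ is a unit. The monoid $M$ is quasi-atomic if for every nonunit $c \in M$ there exists $b\in M$ such that $bc$ is a finite product of atoms of $M$. A semidomain $S$ is quasi-atomic if the monoid $S^*$ is quasi-atomic, and the atoms of $S$ are the atoms of $S^*$. An ideal of $S$ is a subset $I\subseteq S$ such that $(I,+)$ is a submonoid of $(S,+)$ and $IS\subseteq I$ (i.e., $is \in I$ for all $i\in I$, $s\in S$). An ideal $I$ is prime if $I\neq S$ and for all $b,c\in S$, $bc\in I$ implies $b\in I$ or $c\in I$. An ideal is nonzero if it is different from $\{0\}$. *)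

(* Defs.v *)
From HB Require Import structures.
From mathcomp Require Import all_boot all_algebra.
From mathcomp Require Import classical_sets.

Set Implicit Arguments.
Unset Strict Implicit.
Unset Printing Implicit Defensive.

Import GRing.Theory.

Local Open Scope ring_scope.

HB.mixin Record Monoid_isComCancel M of monoid.Monoid M := {
  cmulgC : commutative (@monoid.mul M);
  cmulgI : right_injective (@monoid.mul M)
}.

#[short(type="ccMonoidType")]
HB.structure Definition CCMonoid :=
  { M of Monoid_isComCancel M & monoid.Monoid M }.

Definition invertible (M : ccMonoidType) (a : M) : Prop :=
  exists b : M, (a * b = 1)%g.

Definition atom (M : ccMonoidType) (a : M) : Prop :=
  ~ invertible a /\
  forall b c : M, a = (b * c)%g -> invertible b \/ invertible c.

Definition quasi_atomic (M : ccMonoidType) : Prop :=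
  forall c : M, ~ invertible c ->
    exists (b : M) (s : seq M),
      (forall a, a \in s -> atom a) /\ (b * c = \prod_(a <- s) a)%g.

(* Cancellativity of addition is not a separate field: it follows, like
   1 != 0, from the embedding into an integral domain. *)
HB.mixin Record isSemidomain S of GRing.ComPzSemiRing S := {
  semidomain_embedding :
    exists (R : idomainType) (f : {rmorphism S -> R}), injective f
}.

#[short(type="semidomainType")]
HB.structure Definition Semidomain :=
  { S of isSemidomain S & GRing.ComPzSemiRing S }.

Section SemidomainTheory.
Variable S : semidomainType.

Lemma semidomain_addrI : right_injective (@GRing.add S).
Proof.
have [R [f finj]] := @semidomain_embedding S.
move=> x y z /(congr1 f); rewrite !rmorphD => /addrI; exact: finj.
Qed.

Lemma semidomain_oner_neq0 : (1 : S) != 0.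
Proof.
have [R [f finj]] := @semidomain_embedding S.
apply/eqP => /(congr1 f); rewrite rmorph0 rmorph1 => /eqP.
by rewrite oner_eq0.
Qed.

Lemma semidomain_mulf_neq0 (x y : S) : x != 0 -> y != 0 -> x * y != 0.
Proof.
have [R [f finj]] := @semidomain_embedding S.
have f_neq0 z : z != 0 -> f z != 0.
  by apply: contraNneq => fz0; apply/eqP/finj; rewrite rmorph0.
move=> /f_neq0 fx0 /f_neq0 fy0; apply/eqP => /(congr1 f) /eqP.
by rewrite rmorphM rmorph0 mulf_eq0 (negbTE fx0) (negbTE fy0).
Qed.

Lemma semidomain_mulfI (x y z : S) : x != 0 -> x * y = x * z -> y = z.
Proof.
have [R [f finj]] := @semidomain_embedding S.
move=> x0 /(congr1 f); rewrite !rmorphM => fE; apply: (finj); move: fE.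
by apply: mulfI; apply: contraNneq x0 => fx0; apply/eqP/finj; rewrite rmorph0.
Qed.

End SemidomainTheory.

(* The multiplicative monoid of the nonzero elements of S. *)
Definition nonzero (S : semidomainType) := {x : S | x != 0}.

HB.instance Definition _ (S : semidomainType) := SubChoice.on (nonzero S).

Section NonzeroMonoid.
Variable S : semidomainType.
Implicit Types x y z : nonzero S.

Definition nonzero_one : nonzero S := exist _ 1 (semidomain_oner_neq0 S).

Definition nonzero_mul x y : nonzero S :=
  exist _ (val x * val y) (semidomain_mulf_neq0 (valP x) (valP y)).

Lemma nonzero_mulA : associative nonzero_mul.
Proof. by move=> x y z; apply: val_inj; rewrite /= mulrA. Qed.

Lemma nonzero_mul1 : left_id nonzero_one nonzero_mul.
Proof. by move=> x; apply: val_inj; rewrite /= mul1r. Qed.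

Lemma nonzero_mulr1 : right_id nonzero_one nonzero_mul.
Proof. by move=> x; apply: val_inj; rewrite /= mulr1. Qed.

HB.instance Definition _ := isMonoid.Build (nonzero S)
  nonzero_mulA nonzero_mul1 nonzero_mulr1.

Lemma nonzero_mulC : commutative (@monoid.mul (nonzero S)).
Proof. by move=> x y; apply: val_inj; rewrite /= mulrC. Qed.

Lemma nonzero_mulI : right_injective (@monoid.mul (nonzero S)).
Proof.
move=> x y z /(congr1 val) /= h; apply: val_inj.
exact: semidomain_mulfI (valP x) h.
Qed.

HB.instance Definition _ :=
  Monoid_isComCancel.Build (nonzero S) nonzero_mulC nonzero_mulI.

End NonzeroMonoid.

Definition semidomain_quasi_atomic (S : semidomainType) : Prop :=
  quasi_atomic (nonzero S).

Definition semidomain_atom (S : semidomainType) (a : S) : Prop :=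
  exists2 u : nonzero S, atom u & val u = a.

Local Open Scope classical_set_scope.

Definition ideal (S : semidomainType) (I : set S) : Prop :=
  [/\ I 0,
      forall x y : S, I x -> I y -> I (x + y) &
      forall i s : S, I i -> I (i * s)].

Definition prime_ideal (S : semidomainType) (I : set S) : Prop :=
  [/\ ideal I,
      I <> [set: S] &
      forall b c : S, I (b * c) -> I b \/ I c].

(* Main.v *)
(** If [c] is nonzero and no multiple of [c] is a product of atoms, then the
    ideal [c S] is disjoint from the multiplicative set of products of atoms.
    An ideal maximal among those containing [c S] and disjoint from that set
    is prime, nonzero, and contains no atom. Conversely, a prime ideal
    containing a nonzero [c] contains every product [b c] of atoms, hence one
    of the factors. *)

Require Import Defs.
From mathcomp Require Import all_boot all_algebra classical_sets.
From mathcomp Require Import boolp.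

Set Implicit Arguments.
Unset Strict Implicit.
Unset Printing Implicit Defensive.

Import GRing.Theory.

Local Open Scope ring_scope.
Local Open Scope classical_set_scope.

Section PrimeAvoidance.
Variables (S : semidomainType) (T : set S).
Implicit Types (I J P : set S) (x y c : S).

Definition disjoint_ideal I := ideal I /\ forall x, I x -> ~ T x.

Definition adjoin I x : set S :=
  [set y | exists2 p, I p & exists s, y = p + x * s].

Lemma ideal_adjoin I x : ideal I -> ideal (adjoin I x).
Proof.
move=> [I0 ID IM]; split.
- by exists 0 => //; exists 0; rewrite mulr0 addr0.
- move=> _ _ [p Ip [s ->]] [q Iq [t ->]].
  by exists (p + q); [exact: ID|exists (s + t); rewrite mulrDr addrACA].
- move=> _ t [p Ip [s ->]].
  by exists (p * t); [exact: IM|exists (s * t); rewrite mulrDl mulrA].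
Qed.

Lemma sub_adjoin I x : I `<=` adjoin I x.
Proof. by move=> p Ip; exists p => //; exists 0; rewrite mulr0 addr0. Qed.

Lemma mem_adjoin I x : ideal I -> adjoin I x x.
Proof. by case=> I0 _ _; exists 0 => //; exists 1; rewrite mulr1 add0r. Qed.

Lemma ideal_principal c : ideal [set c * s | s in [set: S]].
Proof.
split; first by exists 0; rewrite ?mulr0.
- by move=> _ _ [s _ <-] [t _ <-]; exists (s + t); rewrite ?mulrDr.
- by move=> _ t [s _ <-]; exists (s * t); rewrite ?mulrA.
Qed.

(** Zorn's lemma applies because any two elements of the union of a chain already lie in one member,
    where their sum can be formed. *)
Lemma ex_maximal_disjoint_ideal I : disjoint_ideal I ->
  exists P, [/\ disjoint_ideal P, I `<=` P &
    forall J, disjoint_ideal J -> P `<=` J -> J `<=` P].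
Proof.
move=> dI.
(* Ranging over [X] with [I `|` X] admissible makes the empty chain harmless. *)
have [F subF totF|A [dA maxA]] :=
    @Zorn_bigcup _ [set X | disjoint_ideal (I `|` X)].
  (* Adding [set0] keeps the union and makes the chain nonempty, so elements of [I] also lie in some
     [I] ∪ [X] with [X] in the chain. *)
  pose G := set0 |` F.
  have -> : \bigcup_(X in F) X = \bigcup_(X in G) X.
    by rewrite bigcup_setU bigcup_set1 set0U.
  have dG X : G X -> disjoint_ideal (I `|` X).
    by case=> [->|/subF //]; rewrite setU0.
  have totG X Y : G X -> G Y -> X `<=` Y \/ Y `<=` X.
    case=> [->|FX]; first by left.
    by case=> [->|FY]; [right|exact: totF].
  have G0 : G set0 by left.
  have memG x : (I `|` \bigcup_(X in G) X) x -> exists2 X, G X & (I `|` X) x.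
    by case=> [Ix|[X GX Xx]]; [exists set0|exists X] => //; [left|right].
  have Gmem X : G X -> I `|` X `<=` I `|` \bigcup_(X in G) X.
    by move=> GX; apply: setUS; exact: bigcup_sup.
  split; last by move=> x /memG[X /dG[_]]; exact.
  split.
  - by have [[I0 _ _] _] := dI; left.
  - move=> x y /memG[X GX Xx] /memG[Y GY Yy].
    have [XY|YX] := totG _ _ GX GY.
    + have [[_ YD _] _] := dG _ GY.
      by apply: (Gmem _ GY); apply: YD => //; exact: setUS Xx.
    + have [[_ XD _] _] := dG _ GX.
      by apply: (Gmem _ GX); apply: XD => //; exact: setUS Yy.
  - move=> x s /memG[X GX Xx]; have [[_ _ XM] _] := dG _ GX.
    by apply: (Gmem _ GX); exact: XM.
exists (I `|` A); split => // J dJ; rewrite subUset => -[IJ AJ].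
(* Otherwise [J] strictly contains [A] and [I] ∪ [J] = [J] is admissible, against the maximality of
   [A]. *)
have [JA|nJA] := pselect (J `<=` A); first by move=> x /JA; right.
by case: (maxA J) => //=; rewrite ((setUidPr _ _).2 IJ).
Qed.

(** For [x], [y] outside [P], maximality makes both P + xS and P + yS meet [T]. The product of the
    two elements found is in [T], yet in [P] as soon as [x * y] is. Properness comes from 1 being in
    [T]. *)
Lemma maximal_disjoint_ideal_prime P : T 1 ->
  (forall x y, T x -> T y -> T (x * y)) -> disjoint_ideal P ->
  (forall J, disjoint_ideal J -> P `<=` J -> J `<=` P) ->
  prime_ideal P.
Proof.
move=> T1 TM [idP PT] maxP.
have meetT x : ~ P x -> exists p s, P p /\ T (p + x * s).
  move=> nPx; apply: contrapT => nT; apply: nPx.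
  apply: (maxP (adjoin P x)); [|exact: sub_adjoin|exact: mem_adjoin].
  split; first exact: ideal_adjoin.
  by move=> _ [p Pp [s ->]] Tps; apply: nT; exists p, s.
split=> // [PS|x y Pxy]; first by apply: (PT 1) T1; rewrite PS.
apply: contrapT => /not_orP[/meetT[p [s [Pp Tps]]] /meetT[q [t [Pq Tqt]]]].
apply: PT (TM _ _ Tps Tqt); have [_ PD PM] := idP.
(* The product becomes p(q + yt) + (q(xs) + (xy)(st)), whose three terms have the left factors [p],
   [q], [x * y] in [P]. *)
rewrite mulrDl [x * s * _]mulrDr [x * s * q]mulrC mulrACA.
by apply: (PD); [exact: PM|apply: (PD); exact: PM].
Qed.

Lemma prime_avoidance I : T 1 -> (forall x y, T x -> T y -> T (x * y)) ->
  disjoint_ideal I ->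
  exists P, [/\ prime_ideal P, I `<=` P & forall x, P x -> ~ T x].
Proof.
move=> T1 TM /ex_maximal_disjoint_ideal[P [dP IP maxP]]; exists P; split=> //.
  exact: maximal_disjoint_ideal_prime.
by case: dP.
Qed.

End PrimeAvoidance.

Definition atom_product (S : semidomainType) : set S :=
  [set x | exists2 s : seq (nonzero S),
    (forall a, a \in s -> atom a) & x = val (\prod_(a <- s) a)%g].

Lemma atom_product1 (S : semidomainType) : @atom_product S 1.
Proof. by exists [::]; rewrite ?big_nil. Qed.

Lemma atom_productM (S : semidomainType) (x y : S) :
  atom_product x -> atom_product y -> atom_product (x * y).
Proof.
move=> [s sat ->] [t tat ->]; exists (s ++ t); last by rewrite big_cat.
by move=> a; rewrite mem_cat => /orP[/sat|/tat].
Qed.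

Lemma atom_product_atom (S : semidomainType) (a : S) :
  semidomain_atom a -> atom_product a.
Proof.
case=> u atu <-; exists [:: u]; last by rewrite big_seq1.
by move=> b; rewrite inE => /eqP ->.
Qed.

Lemma prime_ideal1 (S : semidomainType) (P : set S) : prime_ideal P -> ~ P 1.
Proof.
move=> [[_ _ PM] PS _] P1; apply: PS; apply/seteqP; split=> // x _.
by rewrite -[x]mul1r; exact: PM.
Qed.

(** Induction on [s]: the empty product 1 is never in a prime ideal, and primality splits off one
    factor at a time. *)
Lemma prime_ideal_prod (S : semidomainType) (P : set S) (s : seq (nonzero S)) :
  prime_ideal P -> P (val (\prod_(a <- s) a)%g) ->
  exists2 a, a \in s & P (val a).
Proof.
move=> prP; have [_ _ Pprime] := prP.
elim: s => [|a s IHs]; first by rewrite big_nil => /(prime_ideal1 prP).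
rewrite big_cons => /Pprime[Pa|/IHs[b bs Pb]].
  by exists a; rewrite ?mem_head.
by exists b; rewrite // inE bs orbT.
Qed.

Theorem theorem5p2 (S : semidomainType) :
  semidomain_quasi_atomic S <->
  (forall P : set S, prime_ideal P -> P <> [set 0] ->
     exists a : S, semidomain_atom a /\ P a).
Proof.
split=> [qaS P prP P_neq0|atomP c _].
  have [[P0 _ PM] _ _] := prP.
  have [x [Px x0]] : exists x, P x /\ x != 0.
    apply: contrapT => nx; apply: P_neq0.
    apply/seteqP; split=> x /= => [Px|-> //].
    by apply/eqP; apply: contrapT => /negP x0; apply: nx; exists x.
  pose c : nonzero S := exist _ x x0.
  (* An inverse of [c] would put 1 in [P]. *)
  have nuc : ~ invertible c.
    case=> d /(congr1 val) /= cd1; apply: (prime_ideal1 prP).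
    by have := PM _ (val d) Px; rewrite cd1.
  have [b [s [sat bcs]]] := qaS c nuc.
  have [|a a_s Pa] := @prime_ideal_prod S P s prP.
    by rewrite -bcs /= mulrC; exact: PM.
  by exists (val a); split=> //; exists a; first exact: sat.
apply: contrapT => nqa.
have [|||P [prP cP PT]] := @prime_avoidance S (@atom_product S)
    [set val c * s | s in [set: S]].
- exact: atom_product1.
- exact: atom_productM.
- split; first exact: ideal_principal.
  move=> _ [d _ <-] [s sat cds]; apply: nqa.
  (* The cofactor [d] must live in the monoid of nonzero elements; it does, since a product of atoms
     is nonzero. *)
  have d0 : d != 0.
    apply/eqP => d0; have := valP (\prod_(a <- s) a)%g.
    by rewrite -cds d0 mulr0 eqxx.
  exists (exist _ d d0 : nonzero S), s; split=> //.
  by apply: val_inj; rewrite -cds /= mulrC.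
(* [P] contains [c], so it is nonzero and contains an atom, which as a one-factor product
   contradicts disjointness. *)
- have Pc : P (val c) by apply: cP; exists 1; rewrite ?mulr1.
  have [P0|a [ata Pa]] := atomP P prP.
    by move: Pc; rewrite P0 => /eqP; rewrite (negbTE (valP c)).
  exact: PT Pa (atom_product_atom ata).
Qed.
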